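(* Let $n,\delta,\ell$ be positive integers. Given a multiset $S$ whose elements are from the universe $U=\{1,2,\dots,n\}$ and in which every element has multiplicity at most $\ell$, any data structure that supports ${\textsf{drankA}}$ queries on $S$ with additive error $\delta$ requires at least $\lfloor n/\lceil\delta/\ell\rceil\rfloor\lg(\max(\lfloor\ell/\delta\rfloor,1)+1)$ bits.
   Context: For a multiset $S$ over $\{1,\dots,n\}$, ${\textsf{rank}}(i,S)=|\{j\in S\mid j\le i\}|$ (counted with multiplicity). ${\textsf{drankA}}(i,S,\delta)$ returns any value $r$ with ${\textsf{rank}}(i,S)-\delta<r\le{\textsf{rank}}(i,S)$. The lower bound is over all multisets satisfying the multiplicity bound $\ell$. *)

(* Defs.v *)
From HB Require Import structures.
From mathcomp Require Import all_boot all_order all_algebra.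
From mathcomp Require Import finmap multiset.
From mathcomp Require Import reals exp.

Set Implicit Arguments.
Unset Strict Implicit.
Unset Printing Implicit Defensive.

Import Order.TTheory GRing.Theory Num.Theory.

Local Open Scope mset_scope.
Local Open Scope ring_scope.

Definition in_universe (n i : nat) : bool := (1 <= i <= n)%N.

Definition bounded_mset (n ell : nat) (S : {mset nat}) : Prop :=
  (forall j, j \in S -> in_universe n j) /\ (forall j, (S j <= ell)%N).

(* [S] is coerced to the sequence of its elements, repeated according to
   multiplicity. *)
Definition rank (i : nat) (S : {mset nat}) : nat := count (fun j => (j <= i)%N) S.

(* Answers are in [int] because [rank i S - delta] may be negative. *)
Definition drankA_answer (delta i : nat) (S : {mset nat}) (r : int) : bool :=
  (rank i S)%:Z - delta%:Z < r <= (rank i S)%:Z.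

(* A data structure occupying [b] bits: [encode] is the preprocessing, which
   turns the input multiset into [b] bits of memory, and [query] answers from
   that memory and the query point alone.  Both may depend on [n], [delta] and
   [ell].  Values outside the admissible inputs are unconstrained. *)
Record drankA_structure (n delta ell b : nat) := DrankAStructure {
  encode : {mset nat} -> b.-tuple bool;
  query : b.-tuple bool -> nat -> int;
  queryP : forall (S : {mset nat}) (i : nat),
    bounded_mset n ell S -> in_universe n i ->
    drankA_answer delta i S (query (encode S) i)
}.

(* The ceiling of m / d, for d > 0. *)
Definition ceil_divn (m d : nat) : nat := ((m + d.-1) %/ d)%N.

Definition lg (R : realType) (x : R) : R := ln x / ln 2.

(* Main.v *)
(* Cut the universe into blocks of [c] consecutive elements and give all the
   elements of a block the same multiplicity, a multiple of [w].  When
   [delta <= c * w], the ranks at the ends of the blocks are multiples of a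
   number that is at least the additive error, so an approximate answer
   determines them exactly, and their differences give back the multiplicities.
   The encodings are thus pairwise distinct, and [c = ceil (delta / ell)] with
   [w = min delta ell] leaves [max (floor (ell / delta)) 1 + 1] choices for each
   of [floor (n / c)] blocks. *)
Require Import Defs.
From mathcomp Require Import all_boot all_order all_algebra.
From mathcomp Require Import finmap multiset.
From mathcomp Require Import reals exp.
From mathcomp Require Import zify.

Import Order.TTheory GRing.Theory Num.Theory.
Local Open Scope mset_scope.
Local Open Scope ring_scope.

Lemma sumn_take (s : seq nat) (k : nat) :
  (k <= size s)%N -> sumn (take k s) = (\sum_(0 <= i < k) nth 0 s i)%N.
Proof.
move=> le_ks; rewrite -(map_nth_iota0 0%N) //.
by rewrite sumnE big_map /index_iota subn0.
Qed.

Lemma eq_from_sumn_take (s t : seq nat) :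
    size s = size t ->
    (forall k, (k <= size s)%N -> sumn (take k s) = sumn (take k t)) ->
  s = t.
Proof.
move=> eq_size eq_sumn; apply: (@eq_from_nth _ 0%N) => // k lt_ks.
have := eq_sumn _ lt_ks; rewrite !(take_nth 0%N) -?eq_size // !sumn_rcons.
by rewrite (eq_sumn k (ltnW lt_ks)) => /addnI.
Qed.

Lemma sum_nat_divn (c m : nat) (F : nat -> nat) :
  (\sum_(0 <= j < m * c) F (j %/ c) = c * \sum_(0 <= k < m) F k)%N.
Proof.
rewrite big_nat_mul big_distrr /=; apply: eq_bigr => k _.
rewrite (eq_big_nat _ _ (F2 := fun=> F k)) => [|j /andP[le_kj lt_jk]].
  by rewrite sum_nat_const_nat mulSn addnK.
have c_gt0 : (0 < c)%N by case: c le_kj lt_jk => //; rewrite !muln0.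
by congr F; apply/eqP; rewrite eqn_leq -ltnS ltn_divLR // lt_jk leq_divRL.
Qed.

Lemma leq_ceil_divn_mul (m d : nat) : (0 < d)%N -> (m <= ceil_divn m d * d)%N.
Proof.
move=> d_gt0; have := ltn_ceil (m + d.-1) d_gt0.
by rewrite mulSn /ceil_divn; lia.
Qed.

Lemma leq_ceil_divn_mul_minn (m d : nat) :
  (0 < m)%N -> (0 < d)%N -> (m <= ceil_divn m d * minn m d)%N.
Proof.
move=> m_gt0 d_gt0; case: (leqP m d) => _; last exact: leq_ceil_divn_mul.
by rewrite leq_pmull // divn_gt0 //; lia.
Qed.

Lemma leq_maxn_divn_mul_minn (m d : nat) :
  (maxn (m %/ d) 1 * minn d m <= m)%N.
Proof.
case: (leqP d m) => [le_dm | lt_md]; last by rewrite divn_small ?mul1n.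
case: d le_dm => [|d] le_dm; first by rewrite muln0.
by rewrite (maxn_idPl _) ?leq_trunc_div ?divn_gt0.
Qed.

Lemma rankE (i : nat) (S : {mset nat}) :
  rank i S = (\sum_(0 <= j < i.+1) S j)%N.
Proof.
elim: i => [|i IHi]; rewrite big_nat_recr //=.
  by rewrite big_geq // -count_mem_mset; apply: eq_count => j; rewrite leqn0.
rewrite -IHi -count_mem_mset /rank -count_predUI.
rewrite [X in (_ + X)%N](@eq_count _ _ pred0) => [|j /=]; last by lia.
by rewrite count_pred0 addn0; apply: eq_count => j /=; lia.
Qed.

(* The elements of block [k] are [k * c + 1, ..., k * c + c]. *)
Definition block_mset (c w : nat) (s : seq nat) : {mset nat} :=
  [fsfun j in [fset j in iota 1 (size s * c)]%fset =>
     (w * nth 0 s (j.-1 %/ c))%N].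

Lemma block_msetE (c w : nat) (s : seq nat) (j : nat) :
  block_mset c w s j =
    if in_universe (size s * c) j then (w * nth 0 s (j.-1 %/ c))%N else 0%N.
Proof. by rewrite fsfunE !inE mem_iota. Qed.

Lemma rank_block_mset (c w : nat) (s : seq nat) (k : nat) :
  (k <= size s)%N ->
  rank (k * c) (block_mset c w s) = (c * w * sumn (take k s))%N.
Proof.
move=> le_ks; rewrite rankE big_nat_recl // block_msetE add0n.
rewrite -mulnA sumn_take // [in RHS]big_distrr -sum_nat_divn /=.
apply: eq_big_nat => j /= lt_j; rewrite block_msetE ifT //.
by rewrite /in_universe /= (leq_trans lt_j) // leq_mul2r le_ks orbT.
Qed.

Lemma bounded_block_mset (n ell c w : nat) (s : seq nat) :
    (size s * c <= n)%N -> {in s, forall v, (w * v <= ell)%N} ->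
  bounded_mset n ell (block_mset c w s).
Proof.
move=> le_n le_ell; split=> j.
  rewrite in_mset block_msetE; case: ifP => // /andP[j_gt0 le_j] _.
  by rewrite /in_universe j_gt0 (leq_trans le_j).
rewrite block_msetE; case: ifP => // _.
case: (ltnP (j.-1 %/ c) (size s)) => [lt_s | le_s].
  by rewrite le_ell ?mem_nth.
by rewrite nth_default ?muln0.
Qed.

Lemma drankA_answer_dvdn_inj (delta q i : nat) (S T : {mset nat}) (r : int) :
    (delta <= q)%N -> (q %| rank i S)%N -> (q %| rank i T)%N ->
    drankA_answer delta i S r -> drankA_answer delta i T r ->
  rank i S = rank i T.
Proof.
rewrite /drankA_answer => le_q /dvdnP[x ->] /dvdnP[y ->] rS rT.
case: (ltngtP x y) => [lt_xy | lt_yx | -> //].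
  by have := leq_mul2r q x.+1 y; rewrite lt_xy orbT mulSn; lia.
by have := leq_mul2r q y.+1 x; rewrite lt_yx orbT mulSn; lia.
Qed.

Section EncodingSize.

Variables (n delta ell b : nat) (D : drankA_structure n delta ell b).

Lemma encode_dvdn_rank_inj (q i : nat) (S T : {mset nat}) :
    (delta <= q)%N -> in_universe n i ->
    bounded_mset n ell S -> bounded_mset n ell T ->
    (q %| rank i S)%N -> (q %| rank i T)%N ->
  encode D S = encode D T -> rank i S = rank i T.
Proof.
move=> le_q univ_i bS bT qS qT enc_ST.
apply: (drankA_answer_dvdn_inj _ _ _ _ _ (query D (encode D S) i) le_q qS qT).
  exact: queryP.
by rewrite enc_ST; apply: queryP.
Qed.

Variables (c w : nat).
Hypotheses (delta_gt0 : (0 < delta)%N) (delta_le : (delta <= c * w)%N).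

Lemma encode_block_mset_inj (s t : seq nat) :
    size s = size t -> (size s * c <= n)%N ->
    {in s, forall v, (w * v <= ell)%N} -> {in t, forall v, (w * v <= ell)%N} ->
  encode D (block_mset c w s) = encode D (block_mset c w t) -> s = t.
Proof.
move=> eq_size le_n le_s le_t enc_st; apply: eq_from_sumn_take => // k le_k.
have cw_gt0 : (0 < c * w)%N := leq_trans delta_gt0 delta_le.
case: (posnP k) => [-> | k_gt0]; first by rewrite !take0.
have c_gt0 : (0 < c)%N by move: cw_gt0; rewrite muln_gt0 => /andP[].
have univ_kc : in_universe n (k * c).
  rewrite /in_universe muln_gt0 k_gt0 c_gt0 (leq_trans _ le_n) //.
  by rewrite leq_mul2r le_k orbT.
apply/eqP; rewrite -(eqn_pmul2l cw_gt0) -!rank_block_mset -?eq_size //.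
apply/eqP; apply: (encode_dvdn_rank_inj (c * w)) enc_st => //.
- exact: bounded_block_mset.
- by apply: bounded_block_mset; rewrite -?eq_size.
- by rewrite rank_block_mset // dvdn_mulr.
- by rewrite rank_block_mset -?eq_size // dvdn_mulr.
Qed.

Lemma leq_expn_encode (m M : nat) :
  (m * c <= n)%N -> (M * w <= ell)%N -> (M.+1 ^ m <= 2 ^ b)%N.
Proof.
move=> le_n le_ell.
pose mults (t : m.-tuple 'I_M.+1) : seq nat := map val t.
have mults_le t : {in mults t, forall v, (w * v <= ell)%N}.
  move=> _ /mapP[v _ ->]; apply: leq_trans le_ell.
  by rewrite mulnC leq_mul2r -ltnS ltn_ord orbT.
have encode_inj : injective (fun t => encode D (block_mset c w (mults t))).
  move=> t u enc_tu; apply/val_inj/(inj_map val_inj).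
  by apply: encode_block_mset_inj enc_tu; rewrite ?size_map ?size_tuple.
by have := leq_card _ encode_inj; rewrite !card_tuple card_ord card_bool.
Qed.

End EncodingSize.

Section BinaryLogarithm.

Variable R : realType.
Implicit Types x y : R.

Lemma ln2_gt0 : 0 < ln (2 : R).
Proof. by rewrite ln_gt0 ?ltr1n. Qed.

Lemma lg2 : lg (2 : R) = 1.
Proof. by rewrite /lg divff // gt_eqF // ln2_gt0. Qed.

Lemma lgXn (k : nat) x : 0 < x -> lg (x ^+ k) = k%:R * lg x.
Proof. by move=> x_gt0; rewrite /lg lnXn // mulrA mulr_natl. Qed.

Lemma ler_lg : {in Num.pos &, {mono @lg R : x y / x <= y}}.
Proof.
by move=> x y x_gt0 y_gt0; rewrite ler_pM2r ?invr_gt0 ?ln2_gt0 ?ler_ln.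
Qed.

Lemma leq_expn2_lg (m k d : nat) :
  (k.+1 ^ m <= 2 ^ d)%N -> m%:R * lg (k.+1%:R : R) <= d%:R.
Proof.
rewrite -(ler_nat R) !natrX => le_pow.
rewrite -[leRHS]mulr1 -[X in _ <= _ * X]lg2 -!lgXn ?ltr0Sn //.
by rewrite ler_lg ?posrE ?exprn_gt0 ?ltr0Sn.
Qed.

End BinaryLogarithm.

Theorem theorem6 (R : realType) (n delta ell b : nat)
    (n_gt0 : (0 < n)%N) (delta_gt0 : (0 < delta)%N) (ell_gt0 : (0 < ell)%N)
    (D : drankA_structure n delta ell b) :
  (n %/ ceil_divn delta ell)%:R * lg ((maxn (ell %/ delta) 1 + 1)%:R : R)
    <= b%:R.
Proof.
rewrite addn1; apply: leq_expn2_lg.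
apply: (leq_expn_encode _ _ _ _ D _ (minn delta ell) delta_gt0).
- exact: leq_ceil_divn_mul_minn.
- exact: leq_trunc_div.
- exact: leq_maxn_divn_mul_minn.
Qed.
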